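(* Let $n_1,n_2,n_3$ be positive integers and let $\mu$ be a fixed unit pure quaternion. Every third-order quaternion tensor $\mathcal{A}\in\mathbb{H}^{n_1\times n_2\times n_3}$ can be factorized as $$\mathcal{A}=\mathcal{U}*_\mu\mathcal{S}*_\mu\mathcal{V}^*,$$ where $\mathcal{S}\in\mathbb{H}^{n_1\times n_2\times n_3}$ is f-diagonal, and $\mathcal{U}\in\mathbb{H}^{n_1\times n_1\times n_3}$ and $\mathcal{V}\in\mathbb{H}^{n_2\times n_2\times n_3}$ are unitary. Moreover, $\|\mathcal{A}\|_F=\|\mathcal{S}\|_F$.
   Context: $\mathbb{H}$ is the real quaternion algebra with units $\mathbf{i},\mathbf{j},\mathbf{k}$; $x^*$ and $|x|$ denote conjugate and norm of a quaternion; for a quaternion matrix, $A^*$ is the conjugate transpose. A tensor $\mathcal{A}\in\mathbb{H}^{n_1\times n_2\times n_3}$ is written $\mathcal{A}=\mathcal{A}_{\mathbf e}+\mathcal{A}_{\mathbf i}\mathbf{i}+\mathcal{A}_{\mathbf j}\mathbf{j}+\mathcal{A}_{\mathbf k}\mathbf{k}$ with real tensors $\mathcal{A}_{\mathbf e},\mathcal{A}_{\mathbf i},\mathcal{A}_{\mathbf j},\mathcal{A}_{\mathbf k}$. Its frontal slices are $A^{(k)}=\mathcal{A}(:,:,k)$, and $\|\mathcal{A}\|_F=(\sum|\mathcal{A}_{ijk}|^2)^{1/2}$. $\mathrm{unfold}(\mathcal{A})$ is the $n_1n_3\times n_2$ block column $[A^{(1)};\dots;A^{(n_3)}]$, $\mathrm{fold}$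 is its inverse, and $\mathrm{circ}(\mathcal{A})$ is the $n_1n_3\times n_2n_3$ block circulant matrix with first block column $[A^{(1)};A^{(2)};\dots;A^{(n_3)}]$, i.e. whose $(p,q)$ block is $A^{(s)}$ with $s\equiv p-q+1 \pmod{n_3}$, $1\le s\le n_3$. Fix a unit pure quaternion $\mu=a\mathbf{i}+b\mathbf{j}+c\mathbf{k}$ ($a,b,c$ real, $a^2+b^2+c^2=1$, so $\mu^2=-1$). For a unit pure quaternion $\nu$, $F_{\nu,n}\in\mathbb{H}^{n\times n}$ is the matrix with entries $\frac1{\sqrt n}\left(\cos\frac{2\pi(p-1)(q-1)}{n}-\nu\sin\frac{2\pi(p-1)(q-1)}{n}\right)$. Put $\mu_{\mathbf i}=a\mathbf{i}-b\mathbf{j}-c\mathbf{k}$, $\mu_{\mathbf j}=-a\mathbf{i}+b\mathbf{j}-c\mathbf{k}$, $\mu_{\mathbf k}=-a\mathbf{i}-b\mathbf{j}+c\mathbf{k}$, and $T_\alpha=F_{\mu_\alpha,n_3}^*F_{\mu,n_3}$ for $\alpha\in\{\mathbf{i},\mathbf{j},\mathbf{k}\}$. gQt-product: for $\mathcal{A}\in\mathbb{H}^{n_1\times r\times n_3}$, $\mathcal{B}\in\mathbb{H}^{r\times n_2\times n_3}$, $\mathcal{A}*_\mu\mathcal{B}=\mathrm{fold}\big((\mathrm{circ}(\mathcal{A}_{\mathbf e})+\mathbf{i}\,\mathrm{circ}(\mathcal{A}_{\mathbf i})(T_{\mathbf i}\otimes I_r)+\mathbf{j}\,\mathrm{circ}(\mathcal{A}_{\mathbf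 j})(T_{\mathbf j}\otimes I_r)+\mathbf{k}\,\mathrm{circ}(\mathcal{A}_{\mathbf k})(T_{\mathbf k}\otimes I_r))\,\mathrm{unfold}(\mathcal{B})\big)\in\mathbb{H}^{n_1\times n_2\times n_3}$. Conjugate transpose: for a real tensor $\mathcal{R}\in\mathbb{R}^{n_1\times n_2\times n_3}$, $\mathcal{R}^*\in\mathbb{R}^{n_2\times n_1\times n_3}$ is obtained by transposing each frontal slice and then reversing the order of the transposed slices $2,\dots,n_3$. For a quaternion tensor, $\mathcal{A}^*\in\mathbb{H}^{n_2\times n_1\times n_3}$ is defined by $\mathrm{unfold}(\mathcal{A}^* )=\mathrm{unfold}(\mathcal{A}_{\mathbf e}^* )-(T_{\mathbf i}^*\otimes I_{n_2})\mathrm{unfold}(\mathcal{A}_{\mathbf i}^* )\mathbf{i}-(T_{\mathbf j}^*\otimes I_{n_2})\mathrm{unfold}(\mathcal{A}_{\mathbf j}^* )\mathbf{j}-(T_{\mathbf k}^*\otimes I_{n_2})\mathrm{unfold}(\mathcal{A}_{\mathbf k}^* )\mathbf{k}$. The identity tensor $\mathcal{I}_{nnl}\in\mathbb{H}^{n\times n\times l}$ has first frontal slice $I_n$ and all other frontal slices zero. $\mathcal{U}\in\mathbb{H}^{n\times n\times l}$ is unitary if $\mathcal{U}^**_\mu\mathcal{U}=\mathcal{U}*_\mu\mathcal{U}^*=\mathcal{I}_{nnl}$. A tensor is f-diagonal if each of its frontal slices is a (rectangular) diagonal matrix. *)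

(* Defs.v *)
From HB Require Import structures.
From mathcomp Require Import all_boot all_order all_algebra.
From mathcomp Require Import ring.
From mathcomp Require Import reals trigo.

Set Implicit Arguments.
Unset Strict Implicit.
Unset Printing Implicit Defensive.

Import Order.TTheory GRing.Theory Num.Theory.

Local Open Scope ring_scope.

Record quaternion (R : Type) := Quat { qre : R; qim_i : R; qim_j : R; qim_k : R }.

Section QuaternionEncoding.
Variable R : Type.

Definition prod_of_quat (x : quaternion R) : R * R * R * R :=
  (qre x, qim_i x, qim_j x, qim_k x).

Definition quat_of_prod (t : R * R * R * R) : quaternion R :=
  let: (a, b, c, d) := t in Quat a b c d.

Lemma prod_of_quatK : cancel prod_of_quat quat_of_prod.
Proof. by case. Qed.

End QuaternionEncoding.

HB.instance Definition _ (R : eqType) :=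
  Equality.copy (quaternion R) (can_type (@prod_of_quatK R)).
HB.instance Definition _ (R : choiceType) :=
  Choice.copy (quaternion R) (can_type (@prod_of_quatK R)).

Section QuaternionRing.
Variable R : comNzRingType.
Implicit Types x y z : quaternion R.

Definition addq x y :=
  Quat (qre x + qre y) (qim_i x + qim_i y) (qim_j x + qim_j y) (qim_k x + qim_k y).

Definition oppq x := Quat (- qre x) (- qim_i x) (- qim_j x) (- qim_k x).

Definition mulq x y :=
  let: Quat a b c d := x in
  let: Quat a' b' c' d' := y in
  Quat (a * a' - b * b' - c * c' - d * d')
       (a * b' + b * a' + c * d' - d * c')
       (a * c' - b * d' + c * a' + d * b')
       (a * d' + b * c' - c * b' + d * a').

Definition real_quat (a : R) : quaternion R := Quat a 0 0 0.

Lemma addqA : associative addq.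
Proof. by case=> ? ? ? ? [? ? ? ?] [? ? ? ?]; congr Quat; rewrite /= addrA. Qed.

Lemma addqC : commutative addq.
Proof. by case=> ? ? ? ? [? ? ? ?]; congr Quat; rewrite /= addrC. Qed.

Lemma add0q : left_id (real_quat 0) addq.
Proof. by case=> ? ? ? ?; congr Quat; rewrite /= add0r. Qed.

Lemma addNq : left_inverse (real_quat 0) oppq addq.
Proof. by case=> ? ? ? ?; congr Quat; rewrite /= addNr. Qed.

HB.instance Definition _ :=
  GRing.isZmodule.Build (quaternion R) addqA addqC add0q addNq.

Lemma mulqA : associative mulq.
Proof. by case=> ? ? ? ? [? ? ? ?] [? ? ? ?]; congr Quat; rewrite /=; ring. Qed.

Lemma mul1q : left_id (real_quat 1) mulq.
Proof. by case=> ? ? ? ?; congr Quat; rewrite /=; ring. Qed.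

Lemma mulq1 : right_id (real_quat 1) mulq.
Proof. by case=> ? ? ? ?; congr Quat; rewrite /=; ring. Qed.

Lemma mulqDl : left_distributive mulq addq.
Proof. by case=> ? ? ? ? [? ? ? ?] [? ? ? ?]; congr Quat; rewrite /=; ring. Qed.

Lemma mulqDr : right_distributive mulq addq.
Proof. by case=> ? ? ? ? [? ? ? ?] [? ? ? ?]; congr Quat; rewrite /=; ring. Qed.

Lemma oneq_neq0 : real_quat 1 != 0.
Proof. by apply/eqP => -[] /eqP; rewrite oner_eq0. Qed.

HB.instance Definition _ :=
  GRing.Zmodule_isNzRing.Build (quaternion R) mulqA mul1q mulq1 mulqDl mulqDr
    oneq_neq0.

Definition quat_i : quaternion R := Quat 0 1 0 0.
Definition quat_j : quaternion R := Quat 0 0 1 0.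
Definition quat_k : quaternion R := Quat 0 0 0 1.

Definition conjq x := Quat (qre x) (- qim_i x) (- qim_j x) (- qim_k x).

End QuaternionRing.

Arguments quat_i {R}.
Arguments quat_j {R}.
Arguments quat_k {R}.

Definition normq (R : rcfType) (x : quaternion R) : R :=
  Num.sqrt (qre x ^+ 2 + qim_i x ^+ 2 + qim_j x ^+ 2 + qim_k x ^+ 2).

Definition unit_pure (R : rcfType) (mu : quaternion R) : Prop :=
  qre mu = 0 /\ normq mu = 1.

Section QuaternionMatrix.
Variable R : comNzRingType.

Definition adjq m n (A : 'M[quaternion R]_(m, n)) : 'M[quaternion R]_(n, m) :=
  map_mx (@conjq R) A^T.

(* [c *: A] is left multiplication by [c]; this is right multiplication. *)
Definition scalemx_right m n (A : 'M[quaternion R]_(m, n)) (c : quaternion R) :=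
  map_mx (fun x => x * c) A.

Definition kron m n p q (A : 'M[quaternion R]_(m, n)) (B : 'M[quaternion R]_(p, q)) :
    'M[quaternion R]_((\sum_(i < m) p)%N, (\sum_(j < n) q)%N) :=
  \mxblock_(i < m, j < n) (A i j *: B).

End QuaternionMatrix.

(* Subtraction and opposite modulo n; the library has them only on 'I_n.+1. *)
Definition subo n (p q : 'I_n) : 'I_n :=
  Ordinal (ltn_pmod (p + (n - q))%N (leq_ltn_trans (leq0n p) (ltn_ord p))).

Definition oppo n (p : 'I_n) : 'I_n :=
  Ordinal (ltn_pmod (n - p)%N (leq_ltn_trans (leq0n p) (ltn_ord p))).

(* A third-order tensor is the family of its frontal slices, indexed from 0. *)
Definition tensor (T : Type) (n1 n2 n3 : nat) := {ffun 'I_n3 -> 'M[T]_(n1, n2)}.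

Section Tensor.
Variables (T : Type) (n1 n2 n3 : nat).

Definition unfold_tensor (A : tensor T n1 n2 n3) : 'M[T]_((\sum_(k < n3) n1)%N, n2) :=
  \mxcol_(k < n3) A k.

Definition fold_tensor (X : 'M[T]_((\sum_(k < n3) n1)%N, n2)) : tensor T n1 n2 n3 :=
  [ffun k => submxcol X k].

Definition circ (A : tensor T n1 n2 n3) :
    'M[T]_((\sum_(p < n3) n1)%N, (\sum_(q < n3) n2)%N) :=
  \mxblock_(p < n3, q < n3) A (subo p q).

(* Used for real tensors: with slices indexed from 0, reversing slices
   1, ..., n3 - 1 is k |-> - k modulo n3. *)
Definition trtensor (A : tensor T n1 n2 n3) : tensor T n2 n1 n3 :=
  [ffun k => (A (oppo k))^T].

End Tensor.

Definition map_tensor (T T' : Type) (f : T -> T') n1 n2 n3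
    (A : tensor T n1 n2 n3) : tensor T' n1 n2 n3 :=
  [ffun k => map_mx f (A k)].

Section GQt.
Variable R : realType.
Local Notation H := (quaternion R).

Definition Fmx (nu : H) (n : nat) : 'M[H]_n :=
  \matrix_(p, q)
    let theta := 2 * pi * (p * q)%N%:R / n%:R in
    real_quat (Num.sqrt n%:R)^-1 *
      (real_quat (cos theta) - nu * real_quat (sin theta)).

Definition mu_i (mu : H) : H := Quat 0 (qim_i mu) (- qim_j mu) (- qim_k mu).
Definition mu_j (mu : H) : H := Quat 0 (- qim_i mu) (qim_j mu) (- qim_k mu).
Definition mu_k (mu : H) : H := Quat 0 (- qim_i mu) (- qim_j mu) (qim_k mu).

Definition Tmx (mu mu_alpha : H) (n : nat) : 'M[H]_n :=
  adjq (Fmx mu_alpha n) *m Fmx mu n.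

Definition T_i mu n := Tmx mu (mu_i mu) n.
Definition T_j mu n := Tmx mu (mu_j mu) n.
Definition T_k mu n := Tmx mu (mu_k mu) n.

Definition real_tensor n1 n2 n3 (A : tensor R n1 n2 n3) : tensor H n1 n2 n3 :=
  map_tensor (@real_quat R) A.

Definition part_e n1 n2 n3 (A : tensor H n1 n2 n3) := map_tensor (@qre R) A.
Definition part_i n1 n2 n3 (A : tensor H n1 n2 n3) := map_tensor (@qim_i R) A.
Definition part_j n1 n2 n3 (A : tensor H n1 n2 n3) := map_tensor (@qim_j R) A.
Definition part_k n1 n2 n3 (A : tensor H n1 n2 n3) := map_tensor (@qim_k R) A.

Definition gQt_prod (mu : H) n1 r n2 n3
    (A : tensor H n1 r n3) (B : tensor H r n2 n3) : tensor H n1 n2 n3 :=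
  fold_tensor ((circ (real_tensor (part_e A))
         + quat_i *: (circ (real_tensor (part_i A)) *m kron (T_i mu n3) (1%:M : 'M_r))
         + quat_j *: (circ (real_tensor (part_j A)) *m kron (T_j mu n3) (1%:M : 'M_r))
         + quat_k *: (circ (real_tensor (part_k A)) *m kron (T_k mu n3) (1%:M : 'M_r)))
        *m unfold_tensor B).

Definition conjtr (mu : H) n1 n2 n3 (A : tensor H n1 n2 n3) : tensor H n2 n1 n3 :=
  let term T (Ralpha : tensor R n1 n2 n3) (alpha : H) :=
    scalemx_right
      (kron (adjq T) (1%:M : 'M_n2) *m unfold_tensor (real_tensor (trtensor Ralpha))) alpha in
  fold_tensor (unfold_tensor (real_tensor (trtensor (part_e A)))
        - term (T_i mu n3) (part_i A) quat_i
        - term (T_j mu n3) (part_j A) quat_j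
        - term (T_k mu n3) (part_k A) quat_k).

Definition idtensor (n l : nat) : tensor H n n l :=
  [ffun k : 'I_l => if k == 0 :> nat then 1%:M else 0].

Definition unitary_tensor (mu : H) n l (U : tensor H n n l) : Prop :=
  gQt_prod mu (conjtr mu U) U = idtensor n l /\
  gQt_prod mu U (conjtr mu U) = idtensor n l.

Definition f_diagonal n1 n2 n3 (S : tensor H n1 n2 n3) : Prop :=
  forall k, is_diag_mx (S k).

Definition frobenius n1 n2 n3 (A : tensor H n1 n2 n3) : R :=
  Num.sqrt (\sum_(k < n3) \sum_(i < n1) \sum_(j < n2) normq (A k i j) ^+ 2).

End GQt.

(* Main.v *)
From HB Require Import structures.
From mathcomp Require Import all_boot all_order all_algebra.
From mathcomp Require Import ring.
From mathcomp Require Import spectral complex.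
From mathcomp Require Import reals trigo.
Require Import Defs.

(** The product, the conjugate transpose and the Frobenius norm all become slicewise
    under the discrete Fourier transform along the third mode: with
    z = exp(- 2 pi mu / n3), put hat A (t) = sum_s z^(t s) A_s.  Writing
    A = A_e + i A_i + j A_j + k A_k with real A_al, the powers of z commute with the real
    slices, while z al = al z' for the root z' with axis mu_al instead of mu.  So the
    al-part of A is al times a transform with axis mu_al, and the factor
    T_al = F_(mu_al)^* F_mu in the product turns the mu-transform of the right operand
    into a mu_al-transform, on which the real convolution theorem applies.  Hence
    hat (A * B) (t) = hat A (t) hat B (t) [dft_gQt_prod]; in the same way
    hat (A^* ) (t) = (hat A (t))^* [dft_conjtr], and the transform of the identity tensor
    is I in every slice [dft_idtensor].  The Fourier matrices are unitary [Fmx_unitary],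
    so the transform is a bijection that multiplies the squared Frobenius norm by n3
    [parseval].  It therefore suffices to take a singular value decomposition of each
    slice hat A (t) and to transform the factors back; the inverse transform combines
    slices linearly, so it keeps diagonal slices diagonal.

    The decomposition of a quaternion matrix [quaternion_svd] goes by induction on the
    number of rows.  For A <> 0 the Hermitian matrix A^* A is nonzero, and, viewed as a
    real symmetric operator, it has an eigenvector v with a nonzero real eigenvalue l
    [hermitian_nonzero_eigenvalue].  Then A maps the line of v to that of A v, and A^*
    maps the line of A v back because A^* A v = l v.  Householder reflections that
    rotate v and A v onto the first coordinate axes [householder] bring A to the block
    form diag(s, B), and B is smaller.  The diagonal entries are
    allowed to be arbitrary quaternions, which spares the phase normalization. *)

Set Implicit Arguments.
Unset Strict Implicit.
Unset Printing Implicit Defensive.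

Import Order.TTheory GRing.Theory Num.Theory.

Local Open Scope ring_scope.

(** * Quaternions *)

Section QuaternionAlgebra.
Variable R : comNzRingType.
Implicit Types (a : R) (x y : quaternion R).

Lemma quatP x y :
  [/\ qre x = qre y, qim_i x = qim_i y, qim_j x = qim_j y & qim_k x = qim_k y] ->
  x = y.
Proof. by case: x y => [? ? ? ?] [? ? ? ?] /= [-> -> -> ->]. Qed.

Lemma qre_is_zmod_morphism : zmod_morphism (@qre R).
Proof. by case=> ? ? ? ? []. Qed.
Lemma qim_i_is_zmod_morphism : zmod_morphism (@qim_i R).
Proof. by case=> ? ? ? ? []. Qed.
Lemma qim_j_is_zmod_morphism : zmod_morphism (@qim_j R).
Proof. by case=> ? ? ? ? []. Qed.
Lemma qim_k_is_zmod_morphism : zmod_morphism (@qim_k R).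
Proof. by case=> ? ? ? ? []. Qed.
HB.instance Definition _ :=
  GRing.isZmodMorphism.Build _ _ (@qre R) qre_is_zmod_morphism.
HB.instance Definition _ :=
  GRing.isZmodMorphism.Build _ _ (@qim_i R) qim_i_is_zmod_morphism.
HB.instance Definition _ :=
  GRing.isZmodMorphism.Build _ _ (@qim_j R) qim_j_is_zmod_morphism.
HB.instance Definition _ :=
  GRing.isZmodMorphism.Build _ _ (@qim_k R) qim_k_is_zmod_morphism.

Lemma quat0E : ((qre (0 : quaternion R) = 0) * (qim_i (0 : quaternion R) = 0) *
  (qim_j (0 : quaternion R) = 0) * (qim_k (0 : quaternion R) = 0))%type.
Proof. by []. Qed.

Lemma quat1E : ((qre (1 : quaternion R) = 1) * (qim_i (1 : quaternion R) = 0) *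
  (qim_j (1 : quaternion R) = 0) * (qim_k (1 : quaternion R) = 0))%type.
Proof. by []. Qed.

Lemma quatNE x : ((qre (- x) = - qre x) * (qim_i (- x) = - qim_i x) *
  (qim_j (- x) = - qim_j x) * (qim_k (- x) = - qim_k x))%type.
Proof. by []. Qed.

Lemma quatDE x y : ((qre (x + y) = qre x + qre y)%R *
  (qim_i (x + y) = qim_i x + qim_i y)%R * (qim_j (x + y) = qim_j x + qim_j y)%R *
  (qim_k (x + y) = qim_k x + qim_k y)%R)%type.
Proof. by []. Qed.

Lemma quatME x y : ((qre (x * y) =
    qre x * qre y - qim_i x * qim_i y - qim_j x * qim_j y - qim_k x * qim_k y)%R *
  (qim_i (x * y) =
    qre x * qim_i y + qim_i x * qre y + qim_j x * qim_k y - qim_k x * qim_j y)%R *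
  (qim_j (x * y) =
    qre x * qim_j y - qim_i x * qim_k y + qim_j x * qre y + qim_k x * qim_i y)%R *
  (qim_k (x * y) =
    qre x * qim_k y + qim_i x * qim_j y - qim_j x * qim_i y + qim_k x * qre y)%R)%type.
Proof. by case: x y => [? ? ? ?] []. Qed.

Definition quatE := (quat0E, quat1E, quatNE, quatDE, quatME).

Lemma real_quat_is_zmod_morphism : zmod_morphism (@real_quat R).
Proof. by move=> a b; apply: quatP; rewrite !quatE /= !subr0. Qed.
Lemma real_quat_is_monoid_morphism : monoid_morphism (@real_quat R).
Proof. by split=> // a b; apply: quatP; rewrite !quatE /=; split; ring. Qed.
HB.instance Definition _ :=
  GRing.isZmodMorphism.Build _ _ (@real_quat R) real_quat_is_zmod_morphism.
HB.instance Definition _ :=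
  GRing.isMonoidMorphism.Build _ _ (@real_quat R) real_quat_is_monoid_morphism.

Lemma real_quatC a x : real_quat a * x = x * real_quat a.
Proof. by apply: quatP; rewrite !quatE /=; split; ring. Qed.

Lemma conjq_is_zmod_morphism : zmod_morphism (@conjq R).
Proof. by move=> x y; apply: quatP; rewrite !quatE /=; split=> //; ring. Qed.
HB.instance Definition _ :=
  GRing.isZmodMorphism.Build _ _ (@conjq R) conjq_is_zmod_morphism.

Lemma conjqM x y : conjq (x * y) = conjq y * conjq x.
Proof. by apply: quatP; rewrite /= !quatE /=; split; ring. Qed.

Lemma conjqK : involutive (@conjq R).
Proof. by case=> a b c d; apply: quatP; rewrite /= !opprK. Qed.

Lemma conjq_real a : conjq (real_quat a) = real_quat a.
Proof. by apply: quatP; rewrite /= !oppr0. Qed.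

Lemma conjq1 : conjq 1 = 1 :> quaternion R.
Proof. exact: conjq_real. Qed.

Definition normsq x := qre x ^+ 2 + qim_i x ^+ 2 + qim_j x ^+ 2 + qim_k x ^+ 2.

Lemma mul_conjq x : conjq x * x = real_quat (normsq x).
Proof. by apply: quatP; rewrite /normsq !quatE /=; split; ring. Qed.

Lemma mulq_conj x : x * conjq x = real_quat (normsq x).
Proof. by apply: quatP; rewrite /normsq !quatE /=; split; ring. Qed.

Lemma normsq_real a : normsq (real_quat a) = a ^+ 2.
Proof. by rewrite /normsq /=; ring. Qed.

Lemma normsqM x y : normsq (x * y) = normsq x * normsq y.
Proof. by rewrite /normsq !quatE; ring. Qed.

Lemma normsq_conj x : normsq (conjq x) = normsq x.
Proof. by rewrite /normsq /= !sqrrN. Qed.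

End QuaternionAlgebra.

Section QuaternionNorm.
Variable R : rcfType.
Implicit Types (a : R) (x y : quaternion R).

Lemma normsq_ge0 x : 0 <= normsq x.
Proof. by rewrite !addr_ge0 ?sqr_ge0. Qed.

Lemma normsq_eq0 x : (normsq x == 0) = (x == 0).
Proof.
apply/eqP/eqP => [|->]; last by rewrite /normsq !quatE; ring.
case: x => a b c d; rewrite /normsq /= => /eqP.
rewrite !paddr_eq0 ?addr_ge0 ?sqr_ge0 // !sqrf_eq0.
by case/andP=> /andP[/andP[/eqP-> /eqP->] /eqP->] /eqP->.
Qed.

Lemma normsq_normq x : normq x ^+ 2 = normsq x.
Proof. by rewrite sqr_sqrtr ?normsq_ge0. Qed.

Lemma quat_invertible x : x != 0 -> exists y, y * x = 1 /\ x * y = 1.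
Proof.
rewrite -normsq_eq0 => x_neq0; exists (real_quat (normsq x)^-1 * conjq x); split.
  by rewrite -mulrA mul_conjq -rmorphM mulVf.
by rewrite mulrA -real_quatC -mulrA mulq_conj -rmorphM mulVf.
Qed.

End QuaternionNorm.

(** * Adjoints, unitary matrices and Householder reflections *)

Section Adjoint.
Variable R : comNzRingType.
Local Notation H := (quaternion R).

Lemma adjqE m n (A : 'M[H]_(m, n)) i j : adjq A i j = conjq (A j i).
Proof. by rewrite !mxE. Qed.

Lemma adjqK m n (A : 'M[H]_(m, n)) : adjq (adjq A) = A.
Proof. by apply/matrixP=> i j; rewrite !mxE conjqK. Qed.

Lemma adjqM m n p (A : 'M[H]_(m, n)) (B : 'M[H]_(n, p)) :
  adjq (A *m B) = adjq B *m adjq A.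
Proof.
apply/matrixP=> i j; rewrite !mxE raddf_sum /=.
by apply: eq_bigr => k _; rewrite !mxE conjqM.
Qed.

Lemma adjqD m n (A B : 'M[H]_(m, n)) : adjq (A + B) = adjq A + adjq B.
Proof. by apply/matrixP=> i j; rewrite !mxE raddfD. Qed.

Lemma adjqN m n (A : 'M[H]_(m, n)) : adjq (- A) = - adjq A.
Proof. by apply/matrixP=> i j; rewrite !mxE raddfN. Qed.

Lemma adjq0 m n : adjq (0 : 'M[H]_(m, n)) = 0.
Proof. by apply/matrixP=> i j; rewrite !mxE raddf0. Qed.

Lemma adjq1 n : adjq (1%:M : 'M[H]_n) = 1%:M.
Proof.
apply/matrixP=> i j; rewrite !mxE eq_sym.
by case: (i == j); rewrite ?conjq1 ?raddf0.
Qed.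

Lemma adjq_realZ m n a (A : 'M[H]_(m, n)) :
  adjq (real_quat a *: A) = real_quat a *: adjq A.
Proof. by apply/matrixP=> i j; rewrite !mxE conjqM conjq_real real_quatC. Qed.

(** Over a noncommutative ring only a central scalar can cross the left factor. *)
Lemma mulmx_realZ m n p a (A : 'M[H]_(m, n)) (B : 'M[H]_(n, p)) :
  A *m (real_quat a *: B) = real_quat a *: (A *m B).
Proof.
apply/matrixP=> i j; rewrite !mxE mulr_sumr.
by apply: eq_bigr => k _; rewrite !mxE !mulrA real_quatC.
Qed.

Lemma adjq_block m1 m2 n1 n2 (A : 'M[H]_(m1, n1)) (B : 'M[H]_(m1, n2))
    (C : 'M[H]_(m2, n1)) (D : 'M[H]_(m2, n2)) :
  adjq (block_mx A B C D) = block_mx (adjq A) (adjq C) (adjq B) (adjq D).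
Proof. by rewrite /adjq tr_block_mx map_block_mx. Qed.

Definition unitaryq n (U : 'M[H]_n) := adjq U *m U = 1%:M /\ U *m adjq U = 1%:M.

Lemma unitaryq1 n : unitaryq (1%:M : 'M[H]_n).
Proof. by split; rewrite adjq1 mulmx1. Qed.

Lemma unitaryq_adj n (U : 'M[H]_n) : unitaryq U -> unitaryq (adjq U).
Proof. by case=> ? ?; split; rewrite adjqK. Qed.

Lemma unitaryqM n (U V : 'M[H]_n) : unitaryq U -> unitaryq V -> unitaryq (U *m V).
Proof.
move=> [U1 U2] [V1 V2]; split; rewrite adjqM.
  by rewrite mulmxA -(mulmxA _ _ U) U1 mulmx1.
by rewrite mulmxA -(mulmxA U) V2 mulmx1.
Qed.

Lemma unitaryq_block n (U : 'M[H]_n) :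
  unitaryq U -> unitaryq (block_mx 1%:M 0 0 U : 'M_(1 + n)).
Proof.
move=> [U1 U2]; split; rewrite adjq_block !adjq0 adjq1 mulmx_block.
  by rewrite !mulmx0 !mul0mx !addr0 add0r mulmx1 U1 -scalar_mx_block.
by rewrite !mulmx0 !mul0mx !addr0 add0r mulmx1 U2 -scalar_mx_block.
Qed.

Definition sqfrob m n (A : 'M[H]_(m, n)) := \sum_i \sum_j normsq (A i j).

Lemma sqfrob_sum_col m n (A : 'M[H]_(m, n)) :
  sqfrob A = \sum_j sqfrob (col j A).
Proof.
rewrite /sqfrob exchange_big; apply: eq_bigr => j _; apply: eq_bigr => i _.
by rewrite big_ord1 mxE.
Qed.

Lemma mul_adjq_col n (x : 'cV[H]_n) : adjq x *m x = (real_quat (sqfrob x))%:M.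
Proof.
apply/matrixP=> i j; rewrite !ord1 !mxE mulr1n rmorph_sum; apply: eq_bigr => k _.
by rewrite big_ord1 !mxE mul_conjq.
Qed.

(** The columns may be treated separately, and |U x|^2 = x^* U^* U x. *)
Lemma sqfrob_mul m n p (U : 'M[H]_(m, n)) (A : 'M[H]_(n, p)) :
  adjq U *m U = 1%:M -> sqfrob (U *m A) = sqfrob A.
Proof.
move=> U1; rewrite !sqfrob_sum_col; apply: eq_bigr => j _.
have := mul_adjq_col (col j (U *m A)).
rewrite colE -mulmxA -colE adjqM mulmxA -(mulmxA _ _ U) U1 mulmx1 mul_adjq_col.
by move=> /matrixP /(_ 0 0); rewrite !mxE !mulr1n => -[->].
Qed.

Lemma sqfrob_adj m n (A : 'M[H]_(m, n)) : sqfrob (adjq A) = sqfrob A.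
Proof.
rewrite /sqfrob exchange_big; apply: eq_bigr => i _; apply: eq_bigr => j _.
by rewrite !mxE normsq_conj.
Qed.

End Adjoint.

Section Householder.
Variable R : rcfType.
Local Notation H := (quaternion R).

Lemma sqfrob_eq0 m n (A : 'M[H]_(m, n)) : (sqfrob A == 0) = (A == 0).
Proof.
apply/eqP/eqP => [A0|->]; last first.
  by rewrite /sqfrob big1 // => i _; rewrite big1 // => j _;
     apply/eqP; rewrite normsq_eq0 mxE.
apply/matrixP=> i j; apply/eqP; rewrite mxE -normsq_eq0; apply/eqP.
have ge0 k : 0 <= \sum_l normsq (A k l) by apply: sumr_ge0 => l _; apply: normsq_ge0.
have row_eq0 : \sum_l normsq (A i l) = 0.
  by apply: (psumr_eq0P _ A0) => // k _; apply: ge0.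
by apply: (psumr_eq0P _ row_eq0) => // l _; apply: normsq_ge0.
Qed.

Lemma sqfrob_ge0 m n (A : 'M[H]_(m, n)) : 0 <= sqfrob A.
Proof. by apply: sumr_ge0 => i _; apply: sumr_ge0 => j _; apply: normsq_ge0. Qed.

(** The quaternion a is - s x / |x|, or any quaternion of norm s when x = 0. *)
Lemma exists_opposite_phase (x : H) (s : R) : 0 <= s ->
  exists2 a : H, normsq a = s ^+ 2 &
    exists2 r : R, 0 <= r & conjq a * x = - real_quat r.
Proof.
move=> s_ge0; have [->|x_neq0] := eqVneq x 0.
  exists (real_quat s); first by rewrite normsq_real.
  by exists 0; rewrite // mulr0 (rmorph0 (@real_quat R)) oppr0.
have nx_neq0 : normq x != 0 by rewrite -sqrf_eq0 normsq_normq normsq_eq0.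
exists (real_quat (- (s / normq x)) * x).
  by rewrite normsqM normsq_real -normsq_normq sqrrN -exprMn divfK.
exists (s * normq x); first by rewrite mulr_ge0 ?sqrtr_ge0.
rewrite conjqM conjq_real -real_quatC -mulrA mul_conjq -rmorphM -normsq_normq.
by rewrite -raddfN; congr real_quat; field.
Qed.

(** The reflection W = I - w w^* / b, with w = v - e_0 a, sends v to e_0 a as soon as v and
    e_0 a have the same norm and v^* e_0 a is real; the sign of that real number keeps
    w away from 0. *)
Lemma householder n (v : 'cV[H]_(1 + n)) : v != 0 ->
  exists2 W : 'M[H]_(1 + n), unitaryq W &
    exists2 a : H, a != 0 & W *m v = col_mx a%:M 0.
Proof.
move=> v_neq0; set N := sqfrob v.
have N_gt0 : 0 < N by rewrite lt_def sqfrob_eq0 v_neq0 sqfrob_ge0.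
have [a na [r r_ge0 ar]] := exists_opposite_phase (v 0 0) (sqrtr_ge0 N).
rewrite sqr_sqrtr ?ltW // in na.
pose e : 'cV[H]_(1 + n) := col_mx a%:M 0.
(* w^* w = 2 b, and w^* v = b: hence W v = v - w. *)
pose w := v - e; pose b := N + r.
have b_gt0 : 0 < b by rewrite ltr_wpDr.
have ev : adjq e *m v = - (real_quat r)%:M.
  rewrite -[v]vsubmxK /adjq tr_col_mx map_row_mx mul_row_col trmx0.
  rewrite map_mx0 mul0mx addr0; apply/matrixP=> i j.
  rewrite !ord1 !mxE big_ord1 !mxE !mulr1n -ar; congr (_ * v _ _).
  by apply/val_inj.
have wv : adjq w *m v = (real_quat b)%:M.
  rewrite adjqD adjqN mulmxDl mulNmx ev mul_adjq_col opprK.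
  by rewrite -raddfD /= -rmorphD.
have ve : adjq v *m e = - (real_quat r)%:M.
  rewrite -[adjq v *m e]adjqK adjqM adjqK ev adjqN; congr (- _).
  by apply/matrixP=> i j; rewrite !ord1 !mxE conjq_real.
have ee : sqfrob e = N.
  rewrite /sqfrob big_split_ord /= big_ord1 [X in _ + X]big1 => [|i _].
    by rewrite big_ord1 addr0 col_mxEu mxE.
  by rewrite big_ord1 col_mxEd mxE; apply/eqP; rewrite normsq_eq0.
have ww : adjq w *m w = (real_quat (b + b))%:M.
  rewrite {2}/w mulmxBr wv adjqD adjqN mulmxDl mulNmx ve mul_adjq_col ee.
  by apply/matrixP=> i j; rewrite !ord1 !mxE !mulr1n; apply: quatP;
     rewrite !quatE /= /b; split; ring.
pose W := 1%:M - real_quat b^-1 *: (w *m adjq w).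
have W_adj : adjq W = W.
  by rewrite adjqD adjqN adjq1 adjq_realZ adjqM adjqK.
have W_mul p (x : 'M_(_, p)) : W *m x = x - real_quat b^-1 *: (w *m (adjq w *m x)).
  by rewrite mulmxBl mul1mx -scalemxAl mulmxA.
have wW : adjq w *m W = - adjq w.
  rewrite mulmxBr mulmx1 mulmx_realZ mulmxA ww mul_scalar_mx scalerA -rmorphM.
  rewrite mulrDr mulVf ?gt_eqF // rmorphD rmorph1 scalerDl scale1r.
  by rewrite opprD addNKr.
have WW : W *m W = 1%:M by rewrite W_mul wW mulmxN scalerN opprK subrK.
exists W; first by split; rewrite W_adj.
exists a; first by rewrite -normsq_eq0 na gt_eqF.
rewrite W_mul wv -scalemx1 mulmx_realZ mulmx1 scalerA -rmorphM mulVf ?gt_eqF //.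
by rewrite rmorph1 scale1r subKr.
Qed.

End Householder.

(** * Eigenvectors of Hermitian quaternion matrices *)

(** A nonzero symmetric matrix is diagonalizable over the complex numbers with real
    eigenvalues that are not all zero; the corresponding eigenvector can then be taken
    over the base field. *)
Lemma symmetric_nonzero_eigenvalue (R : rcfType) n (M : 'M[R]_n) :
  M^T = M -> M != 0 ->
  exists2 l : R, l != 0 & exists2 x : 'cV_n, x != 0 & M *m x = l *: x.
Proof.
move=> M_sym M_neq0; pose MC := map_mx (real_complex R) M.
have MC_herm : MC \is hermsymmx.
  apply: realsym_hermsym.
    by apply/is_hermitianmxP; rewrite expr0 scale1r map_mx_id // /MC map_trmx M_sym.
  by apply/mxOverP=> i j; rewrite mxE complex_real.
have MC_eq := orthomx_spectralP (hermitian_normalmx MC_herm).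
set P := spectralmx MC in MC_eq; set d := spectral_diag MC in MC_eq.
have P_unit : P \in unitmx by apply: spectral_unit.
have d_neq0 : d != 0.
  apply: contra_neq M_neq0 => d0; apply/matrixP=> i j; apply: complexI.
  have /matrixP/(_ i j) : MC = 0 by rewrite MC_eq d0 raddf0 mulmx0 mul0mx.
  by rewrite !mxE.
have [i di_neq0] : exists i, d 0 i != 0.
  apply/existsP; apply: contraNT d_neq0; rewrite negb_exists => /forallP d0.
  by apply/eqP/rowP=> i; have := d0 i; rewrite negbK mxE => /eqP.
have /complex_realP[l dl] : d 0 i \is Num.real.
  by have /mxOverP := hermitian_spectral_diag_real MC_herm; apply.
have : eigenvalue MC l%:C%C.
  apply/eigenvalueP; exists (row i P).
    rewrite {1}MC_eq !mulmxA rowE -!(mulmxA (delta_mx _ _)) mulmxV // mul1mx.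
    by rewrite mulmxA -rowE row_diag_mx dl -scalemxAl.
  apply: contraTneq P_unit => Pi0.
  rewrite unitmxE (expand_det_row _ i) big1 ?unitr0 // => j _.
  by have /rowP/(_ j) := Pi0; rewrite !mxE => ->; rewrite mul0r.
rewrite eigenvalue_map => /eigenvalueP[x xM x_neq0].
exists l; first by apply: contraNneq di_neq0 => l0; rewrite dl l0.
exists x^T; first by rewrite trmx_eq0.
by rewrite -{1}M_sym -trmx_mul xM linearZ.
Qed.

Section RealRepresentation.
Variable R : rcfType.
Local Notation H := (quaternion R).

(** The matrix of v |-> B v on the real coordinates of quaternion vectors. *)
Definition real_rep n (B : 'M[H]_n) : 'M[R]_((n + n) + (n + n)) :=
  let Be := map_mx (@qre R) B in let Bi := map_mx (@qim_i R) B in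
  let Bj := map_mx (@qim_j R) B in let Bk := map_mx (@qim_k R) B in
  block_mx (block_mx Be (- Bi) Bi Be) (block_mx (- Bj) (- Bk) (- Bk) Bj)
           (block_mx Bj Bk Bk (- Bj)) (block_mx Be (- Bi) Bi Be).

Lemma real_rep_sym n (B : 'M[H]_n) : adjq B = B -> (real_rep B)^T = real_rep B.
Proof.
move=> B_herm; have B_tr i j : B i j = conjq (B j i) by rewrite -{1}B_herm !mxE.
have [Be Bi Bj Bk] : [/\ (map_mx (@qre R) B)^T = map_mx (@qre R) B,
    (map_mx (@qim_i R) B)^T = - map_mx (@qim_i R) B,
    (map_mx (@qim_j R) B)^T = - map_mx (@qim_j R) B &
    (map_mx (@qim_k R) B)^T = - map_mx (@qim_k R) B].
  by split; apply/matrixP=> i j; rewrite !mxE B_tr.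
by rewrite /real_rep !tr_block_mx !linearN /= Be Bi Bj Bk !opprK.
Qed.

Lemma real_rep_eq0 n (B : 'M[H]_n) : real_rep B = 0 -> B = 0.
Proof.
move/eqP; rewrite block_mx_eq0 => /and4P[/eqP + _ /eqP + _].
move=> /eqP; rewrite block_mx_eq0 => /and4P[/eqP Be _ /eqP Bi _].
move=> /eqP; rewrite block_mx_eq0 => /and4P[/eqP Bj /eqP Bk _ _].
apply/matrixP=> i j; apply: quatP; rewrite mxE.
by split; [move/matrixP: Be|move/matrixP: Bi|move/matrixP: Bj|move/matrixP: Bk];
   move=> /(_ i j); rewrite !mxE.
Qed.

Definition quat_col n (x : 'cV[R]_((n + n) + (n + n))) : 'cV[H]_n :=
  \col_p Quat (usubmx (usubmx x) p 0) (dsubmx (usubmx x) p 0)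
              (usubmx (dsubmx x) p 0) (dsubmx (dsubmx x) p 0).

Lemma quat_col_eq0 n (x : 'cV[R]_((n + n) + (n + n))) : quat_col x = 0 -> x = 0.
Proof.
move=> /colP x0; rewrite -[x]vsubmxK -[usubmx x]vsubmxK -[dsubmx x]vsubmxK.
suff [-> -> -> ->] : [/\ usubmx (usubmx x) = 0, dsubmx (usubmx x) = 0,
    usubmx (dsubmx x) = 0 & dsubmx (dsubmx x) = 0] by rewrite !col_mx0.
have e p : quat_col x p 0 = 0 by rewrite x0 mxE.
by split; apply/colP=> p; rewrite [RHS]mxE;
   [move/(congr1 (@qre R)): (e p) | move/(congr1 (@qim_i R)): (e p)
   |move/(congr1 (@qim_j R)): (e p) | move/(congr1 (@qim_k R)): (e p)];
   rewrite mxE.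
Qed.

Lemma quat_colZ n a (x : 'cV[R]_((n + n) + (n + n))) :
  quat_col (a *: x) = real_quat a *: quat_col x.
Proof.
by apply/colP=> p; rewrite !mxE; apply: quatP; rewrite !quatE /=; split; ring.
Qed.

Lemma quat_col_mul n (B : 'M[H]_n) x :
  quat_col (real_rep B *m x) = B *m quat_col x.
Proof.
rewrite -[x]vsubmxK -[usubmx x]vsubmxK -[dsubmx x]vsubmxK /real_rep.
rewrite !mul_block_col !add_col_mx /quat_col !(col_mxKu, col_mxKd).
apply/colP=> p; rewrite !mxE; apply: quatP => /=.
rewrite !raddf_sum -!big_split /=.
by split; apply: eq_bigr => q _; rewrite !mxE !quatE /=; ring.
Qed.

(** Left multiplication by a Hermitian matrix is a symmetric operator on the underlying
    real space, and a real eigenvalue commutes with the quaternion coordinates. *)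
Lemma hermitian_nonzero_eigenvalue n (B : 'M[H]_n) : adjq B = B -> B != 0 ->
  exists2 l : R, l != 0 &
    exists2 v : 'cV[H]_n, v != 0 & B *m v = real_quat l *: v.
Proof.
move=> /real_rep_sym B_sym B_neq0.
have /(symmetric_nonzero_eigenvalue B_sym)[l l_neq0 [x x_neq0 Bx]] : real_rep B != 0.
  by apply: contra_neq B_neq0 => /real_rep_eq0.
exists l => //; exists (quat_col x); last by rewrite -quat_col_mul Bx quat_colZ.
by apply: contra_neq x_neq0 => /quat_col_eq0.
Qed.

End RealRepresentation.

(** * Singular value decomposition over the quaternions *)

Section SVD.
Variable R : rcfType.
Local Notation H := (quaternion R).

(** An eigenvector v of A^* A with nonzero eigenvalue makes the line of v and the line
    of A v correspond to each other under both A and A^*; rotating both lines onto the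
    first coordinate axis splits off a 1 x 1 block. *)
Lemma split_singular_value m n (A : 'M[H]_(1 + m, 1 + n)) : A != 0 ->
  exists (U : 'M[H]_(1 + m)) (V : 'M[H]_(1 + n)) (s : H) (B : 'M[H]_(m, n)),
    [/\ unitaryq U, unitaryq V & A = U *m block_mx s%:M 0 0 B *m adjq V].
Proof.
move=> A_neq0.
have AA_herm : adjq (adjq A *m A) = adjq A *m A by rewrite adjqM adjqK.
have AA_neq0 : adjq A *m A != 0.
  apply: contra_neq A_neq0 => AA0; apply/eqP; rewrite -sqfrob_eq0 sqfrob_sum_col.
  apply/eqP/big1 => j _; have := mul_adjq_col (col j A).
  rewrite colE adjqM mulmxA -(mulmxA _ _ A) AA0 mulmx0 mul0mx -colE.
  by move=> /matrixP/(_ 0 0); rewrite !mxE => -[<-].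
have [l l_neq0 [v v_neq0 AAv]] := hermitian_nonzero_eigenvalue AA_herm AA_neq0.
have Av_neq0 : A *m v != 0.
  apply: contra_neq v_neq0 => Av0; move: AAv; rewrite -mulmxA Av0 mulmx0.
  move=> /(congr1 (fun x => real_quat l^-1 *: x)).
  by rewrite scaler0 scalerA -rmorphM mulVf // rmorph1 scale1r.
have [W W_unitary [a a_neq0 Wv]] := householder v_neq0.
have [X X_unitary [c c_neq0 Xu]] := householder Av_neq0.
pose B := X *m A *m adjq W.
have [W1 W2] := W_unitary; have [X1 X2] := X_unitary.
have Ba : B *m col_mx a%:M 0 = col_mx c%:M 0.
  by rewrite -Wv -Xu /B -!mulmxA (mulmxA _ W) W1 mul1mx.
have Bc : adjq B *m col_mx c%:M 0 = real_quat l *: col_mx a%:M 0.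
  rewrite -Wv -Xu /B !adjqM adjqK -!mulmxA (mulmxA _ X) X1 mul1mx (mulmxA (adjq A)) AAv.
  by rewrite mulmx_realZ.
(* Ba kills the lower left block of B, and Bc the upper right one. *)
exists (adjq X), (adjq W), (ulsubmx B 0 0), (drsubmx B).
split; [exact: unitaryq_adj..|].
have [a' [_ aa']] := quat_invertible a_neq0.
have [c' [_ cc']] := quat_invertible c_neq0.
have dl0 : dlsubmx B = 0.
  move: Ba; rewrite -{1}[B]submxK mul_block_col !mulmx0 !addr0 => /eq_col_mx[_].
  move=> /(congr1 (fun M => M *m a'%:M)).
  by rewrite -mulmxA -scalar_mxM aa' mulmx1 mul0mx.
have ur0 : ursubmx B = 0.
  move: Bc; rewrite -{1}[B]submxK adjq_block mul_block_col !mulmx0 !addr0.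
  rewrite scale_col_mx scaler0 => /eq_col_mx[_].
  move=> /(congr1 (fun M => M *m c'%:M)).
  rewrite -mulmxA -scalar_mxM cc' mulmx1 mul0mx => /(congr1 (@adjq _ _ _)).
  by rewrite adjqK adjq0.
have -> : block_mx (ulsubmx B 0 0)%:M 0 0 (drsubmx B) = B.
  by rewrite -mx11_scalar -{1}ur0 -{1}dl0 submxK.
rewrite adjqK /B !mulmxA X1 mul1mx -mulmxA W1 mulmx1.
by [].
Qed.

Definition has_svd m n (A : 'M[H]_(m, n)) :=
  exists (U : 'M[H]_m) (D : 'M[H]_(m, n)) (V : 'M[H]_n),
    [/\ A = U *m D *m adjq V, is_diag_mx D, unitaryq U & unitaryq V].

Lemma has_svd_diag m n (D : 'M[H]_(m, n)) : is_diag_mx D -> has_svd D.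
Proof.
move=> D_diag; exists 1%:M, D, 1%:M.
by rewrite adjq1 mul1mx mulmx1; split=> //; apply: unitaryq1.
Qed.

Lemma has_svd_unitary m n (U : 'M[H]_m) (A : 'M[H]_(m, n)) (V : 'M[H]_n) :
  unitaryq U -> unitaryq V -> has_svd A -> has_svd (U *m A *m adjq V).
Proof.
move=> U_unitary V_unitary [U' [D [V' [-> D_diag U'_unitary V'_unitary]]]].
exists (U *m U'), D, (V *m V'); split=> //; try exact: unitaryqM.
by rewrite adjqM !mulmxA.
Qed.

Lemma has_svd_block m n (s : H) (A : 'M[H]_(m, n)) :
  has_svd A -> has_svd (block_mx s%:M 0 0 A : 'M_(1 + m, 1 + n)).
Proof.
move=> [U [D [V [-> D_diag U_unitary V_unitary]]]].
exists (block_mx 1%:M 0 0 U), (block_mx s%:M 0 0 D), (block_mx 1%:M 0 0 V).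
split; try exact: unitaryq_block.
  rewrite adjq_block !adjq0 adjq1 !mulmx_block.
  by rewrite !(mulmx0, mul0mx, addr0, add0r, mulmx1, mul1mx).
by rewrite is_diag_block_mx // !eqxx D_diag scalar_mx_is_diag.
Qed.

Theorem quaternion_svd m n (A : 'M[H]_(m, n)) : has_svd A.
Proof.
elim: m n A => [|m IHm] n A.
  by rewrite (flatmx0 A); apply/has_svd_diag/mx0_is_diag.
case: n A => [|n] A; first by rewrite (thinmx0 A); apply/has_svd_diag/mx0_is_diag.
have [->|A_neq0] := eqVneq A 0; first exact/has_svd_diag/mx0_is_diag.
have [U [V [s [B [U_unitary V_unitary ->]]]]] := @split_singular_value m n A A_neq0.
exact/(@has_svd_unitary m.+1 n.+1)/has_svd_block.
Qed.

End SVD.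

(** * Quaternion Fourier matrices *)

Section Fourier.
Variable R : realType.
Local Notation H := (quaternion R).
Implicit Types (nu : H) (a b : R).

Definition expq nu a : H := real_quat (cos a) - nu * real_quat (sin a).

Definition rootq nu (n m : nat) : H := expq nu (2 * pi * m%:R / n%:R).

Lemma unit_pure_sqr nu : unit_pure nu -> nu * nu = -1.
Proof.
move=> [nu0 nu1]; have := normsq_normq nu; rewrite nu1 expr1n /normsq nu0 => nuE.
apply: quatP; rewrite !quatE nu0 /=; split; [|ring..].
rewrite nuE; ring.
Qed.

Lemma unit_pure_conj nu : unit_pure nu -> conjq nu = - nu.
Proof. by case=> nu0 _; apply: quatP; rewrite !quatE ?nu0 /= ?nu0 ?oppr0. Qed.

Lemma expq0 nu : expq nu 0 = 1.
Proof. by rewrite /expq cos0 sin0 rmorph0 mulr0 subr0. Qed.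

Lemma expq_re nu a : unit_pure nu -> qre (expq nu a) = cos a.
Proof. by case=> nu0 _; rewrite /expq !quatE nu0 /=; ring. Qed.

Lemma expqD nu a b : unit_pure nu -> expq nu (a + b) = expq nu a * expq nu b.
Proof.
move=> /unit_pure_sqr nu2.
have e : nu * real_quat (sin a) * (nu * real_quat (sin b)) =
    - real_quat (sin a * sin b).
  rewrite mulrA -(mulrA nu) real_quatC !mulrA nu2 mulN1r mulNr -rmorphM //.
rewrite /expq cosD sinD mulrBl !mulrBr e -!mulrA -rmorphM.
rewrite [real_quat _ * (nu * _)]mulrA real_quatC -mulrA -!rmorphM.
by apply: quatP; rewrite !quatE /=; split; ring.
Qed.

Lemma conjq_expq nu a : unit_pure nu -> conjq (expq nu a) = expq nu (- a).
Proof.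
move=> nu_unit; rewrite /expq cosN sinN raddfB /= conjq_real conjqM conjq_real.
by rewrite unit_pure_conj // real_quatC raddfN /= mulrN mulNr.
Qed.

Section RootsOfUnity.
Variables (nu : H) (n : nat).
Hypothesis nu_unit : unit_pure nu.
Hypothesis n_gt0 : (0 < n)%N.
Local Notation z := (rootq nu n).

Let n_neq0 : n%:R != 0 :> R. Proof. by rewrite pnatr_eq0 -lt0n. Qed.

Lemma rootq0 : z 0 = 1.
Proof. by rewrite /rootq mulr0 mul0r expq0. Qed.

Lemma rootqD k m : z (k + m) = z k * z m.
Proof. by rewrite /rootq natrD mulrDr mulrDl expqD. Qed.

Lemma rootqX k m : z (k * m) = z k ^+ m.
Proof.
by elim: m => [|m IHm]; rewrite ?muln0 ?rootq0 // mulnS rootqD exprS IHm.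
Qed.

Lemma rootqn : z n = 1.
Proof.
rewrite /rootq mulfK // mulr_natl /expq cos2pi sin2pi.
by rewrite (rmorph0 (@real_quat R)) mulr0 subr0.
Qed.

Lemma rootq_mod m : z (m %% n) = z m.
Proof. by rewrite {2}(divn_eq m n) rootqD mulnC rootqX rootqn expr1n mul1r. Qed.

Lemma rootq_mulr_mod k m : z (k * (m %% n)) = z (k * m).
Proof. by rewrite ![(k * _)%N]mulnC !rootqX rootq_mod. Qed.

Lemma conjq_rootq_mul m : conjq (z m) * z m = 1.
Proof. by rewrite /rootq conjq_expq // -expqD // addNr expq0. Qed.

Lemma conjq_rootq k m : z (k + m) = 1 -> conjq (z k) = z m.
Proof.
by move=> km; rewrite -[LHS]mulr1 -km rootqD mulrA conjq_rootq_mul mul1r.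
Qed.

Lemma rootq_neq1 d : (0 < d < n)%N -> z d != 1.
Proof.
case/andP=> d_gt0 d_ltn; apply/eqP => /(congr1 (@qre R)).
rewrite /rootq expq_re // => cos1.
(* cos (2 x) = 1 - 2 sin^2 x with 0 < x < pi. *)
pose x : R := pi * d%:R / n%:R.
have sx : 0 < sin x.
  apply: sin_gt0_pi; rewrite /x -mulrA; apply/andP; split.
    by rewrite mulr_gt0 ?pi_gt0 ?divr_gt0 ?ltr0n.
  by rewrite gtr_pMr ?pi_gt0 // ltr_pdivrMr ?ltr0n // mul1r ltr_nat.
move: cos1; have -> : 2 * pi * d%:R / n%:R = x + x by rewrite /x; field.
rewrite cosD -!expr2 => cos1.
have /eqP : 2 * sin x ^+ 2 = 0.
  have -> : 2 * sin x ^+ 2 = cos x ^+ 2 + sin x ^+ 2 - (cos x ^+ 2 - sin x ^+ 2).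
    by ring.
  by rewrite cos2Dsin2 cos1 subrr.
by rewrite mulf_eq0 pnatr_eq0 sqrf_eq0 (gt_eqF sx).
Qed.

(** Multiplying the geometric sum by z^d - 1 gives z^(d n) - 1 = 0, and z^d - 1 is
    invertible unless n divides d. *)
Lemma sum_rootq d : \sum_(s < n) z (d * s) = if (n %| d)%N then n%:R else 0.
Proof.
rewrite (eq_bigr (fun s : 'I_n => z d ^+ s)) => [|s _]; last exact: rootqX.
case: ifP => [/dvdnP[q ->]|nd].
  rewrite mulnC rootqX rootqn expr1n (eq_bigr (fun=> 1)) => [|s _].
    by rewrite big_const_ord iter_addr_0.
  by rewrite expr1n.
have zd_neq1 : z d - 1 != 0.
  rewrite subr_eq0 -rootq_mod rootq_neq1 // ltn_mod n_gt0 andbT lt0n.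
  by rewrite -/(n %| d)%N nd.
have [y [yz _]] := quat_invertible zd_neq1.
rewrite -[LHS]mul1r -yz -mulrA -subrX1.
by rewrite -rootqX mulnC rootqX rootqn expr1n subrr mulr0.
Qed.

(** The conjugate of z^(p s) is z^((n - p) s), which turns the sum into a geometric
    one; n - p + q is a multiple of n only for p = q. *)
Lemma sum_conj_rootq (p q : 'I_n) :
  \sum_(s < n) conjq (z (p * s)) * z (q * s) = if p == q then n%:R else 0.
Proof.
rewrite (eq_bigr (fun s : 'I_n => z ((n - p + q) * s))) => [|s _]; last first.
  rewrite (@conjq_rootq _ ((n - p) * s)) -?rootqD -?mulnDl //.
  by rewrite subnKC 1?ltnW // rootqX rootqn expr1n.
rewrite sum_rootq; congr (if _ then _ else _).
have -> : (n %| n - p + q)%N = (n - p + q == n - p + p %[mod n])%N.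
  by rewrite subnK ?modnn // ltnW.
by rewrite eqn_modDl !modn_small // eq_sym.
Qed.

Lemma rootq_conjC k m : conjq (z k) * z m = z m * conjq (z k).
Proof. by rewrite /rootq conjq_expq // -!expqD // addrC. Qed.

Lemma FmxE (p q : 'I_n) : Fmx nu n p q = real_quat (Num.sqrt n%:R)^-1 * z (p * q).
Proof. by rewrite mxE. Qed.

Lemma Fmx_unitary : unitaryq (Fmx nu n).
Proof.
pose c : R := (Num.sqrt n%:R)^-1.
have ccn : c * c * n%:R = 1 by rewrite -expr2 exprVn sqr_sqrtr ?ler0n // mulVf.
have sum_c (p q : 'I_n) :
    \sum_(s < n) real_quat (c * c) * (conjq (z (p * s)) * z (q * s)) =
    (1%:M : 'M_n) p q.
  rewrite -mulr_sumr sum_conj_rootq mxE; case: (p == q); last by rewrite mulr0.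
  by rewrite -(rmorph_nat (@real_quat R)) -rmorphM /= ccn.
have cc x y : x * real_quat c * (real_quat c * y) = real_quat (c * c) * (x * y).
  by rewrite -(real_quatC c x) rmorphM /= -!mulrA [x * (_ * _)]mulrA -real_quatC !mulrA.
split; apply/matrixP=> p q; rewrite mxE.
  rewrite -sum_c; apply: eq_bigr => s _; rewrite adjqE !FmxE conjqM conjq_real cc.
  by rewrite mulnC [(s * q)%N]mulnC.
have -> : (1%:M : 'M[H]_n) p q = 1%:M q p by rewrite !mxE eq_sym.
rewrite -sum_c; apply: eq_bigr => s _; rewrite adjqE !FmxE conjqM conjq_real.
by rewrite -/c (real_quatC c (z _)) -(real_quatC c (conjq _)) cc rootq_conjC.
Qed.

End RootsOfUnity.

(** This is the source of the axes mu_al: moving an imaginary unit across exp(- nu a)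
    conjugates the axis by that unit. *)
Lemma expq_move nu nu' al a : nu * al = al * nu' -> expq nu a * al = al * expq nu' a.
Proof.
move=> e; rewrite /expq mulrBl mulrBr real_quatC; congr (_ - _).
by rewrite -mulrA real_quatC !mulrA e.
Qed.

Lemma unit_pure_mu_i nu : unit_pure nu -> unit_pure (mu_i nu).
Proof. by move=> [nu0]; rewrite /unit_pure /normq /= nu0 !sqrrN. Qed.

Lemma unit_pure_mu_j nu : unit_pure nu -> unit_pure (mu_j nu).
Proof. by move=> [nu0]; rewrite /unit_pure /normq /= nu0 !sqrrN. Qed.

Lemma unit_pure_mu_k nu : unit_pure nu -> unit_pure (mu_k nu).
Proof. by move=> [nu0]; rewrite /unit_pure /normq /= nu0 !sqrrN. Qed.

Lemma mu_i_move nu : unit_pure nu -> nu * quat_i = quat_i * mu_i nu.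
Proof. by move=> [nu0 _]; apply: quatP; rewrite !quatE /= nu0; split; ring. Qed.

Lemma mu_j_move nu : unit_pure nu -> nu * quat_j = quat_j * mu_j nu.
Proof. by move=> [nu0 _]; apply: quatP; rewrite !quatE /= nu0; split; ring. Qed.

Lemma mu_k_move nu : unit_pure nu -> nu * quat_k = quat_k * mu_k nu.
Proof. by move=> [nu0 _]; apply: quatP; rewrite !quatE /= nu0; split; ring. Qed.

End Fourier.

(** * The transform of a tensor along its third mode *)

Section BlockProducts.
Variable R : comNzRingType.
Local Notation H := (quaternion R).
Implicit Types m r n l : nat.

Definition mode3 m n l l' (T : 'M[H]_(l', l)) (A : tensor H m n l) : tensor H m n l' :=
  [ffun p => \sum_q T p q *: A q].

(** The block circulant matrix of A acts as cyclic convolution along the third mode. *)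
Definition cconv m r n l (A : tensor H m r l) (B : tensor H r n l) : tensor H m n l :=
  [ffun p => \sum_q A (subo p q) *m B q].

Lemma kron_unfold m n l (T : 'M[H]_l) (A : tensor H m n l) :
  kron T (1%:M : 'M_m) *m unfold_tensor A = unfold_tensor (mode3 T A).
Proof.
rewrite /kron /unfold_tensor mxblockEv mxcol_mul; apply/eq_mxcolP=> p.
rewrite mul_mxrow_mxcol ffunE; apply: eq_bigr => q _.
by rewrite -scalemxAl mul1mx.
Qed.

Lemma circ_unfold m r n l (A : tensor H m r l) (B : tensor H r n l) :
  circ A *m unfold_tensor B = unfold_tensor (cconv A B).
Proof.
rewrite /circ /unfold_tensor mxblockEv mxcol_mul; apply/eq_mxcolP=> p.
by rewrite mul_mxrow_mxcol ffunE.
Qed.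

Lemma mode3M m n l1 l2 l3 (S : 'M[H]_(l3, l2)) (T : 'M[H]_(l2, l1))
    (A : tensor H m n l1) :
  mode3 (S *m T) A = mode3 S (mode3 T A).
Proof.
apply/ffunP=> p; rewrite !ffunE.
under eq_bigr => q _ do rewrite mxE scaler_suml.
rewrite exchange_big; apply: eq_bigr => k _; rewrite ffunE scaler_sumr.
by apply: eq_bigr => q _; rewrite scalerA.
Qed.

Lemma mode3_1 m n l (A : tensor H m n l) : mode3 1%:M A = A.
Proof.
apply/ffunP=> p; rewrite ffunE (bigD1 p) //= mxE eqxx scale1r big1 ?addr0 // => q.
by rewrite mxE eq_sym => /negPf->; rewrite scale0r.
Qed.

Lemma mode3Z m n l l' a (T : 'M[H]_(l', l)) (A : tensor H m n l) :
  mode3 (a *: T) A = a *: mode3 T A.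
Proof.
apply/ffunP=> p; rewrite !ffunE scaler_sumr; apply: eq_bigr => q _.
by rewrite mxE scalerA.
Qed.

Lemma mode3D m n l l' (T : 'M[H]_(l', l)) (A B : tensor H m n l) :
  mode3 T (A + B) = mode3 T A + mode3 T B.
Proof.
apply/ffunP=> p; rewrite !ffunE -big_split; apply: eq_bigr => q _.
by rewrite ffunE scalerDr.
Qed.

Lemma fold_unfoldK m n l (A : tensor H m n l) : fold_tensor (unfold_tensor A) = A.
Proof. by apply/ffunP=> k; rewrite ffunE mxcolK. Qed.

Lemma unfold_tensorD m n l (A B : tensor H m n l) :
  unfold_tensor (A + B) = unfold_tensor A + unfold_tensor B.
Proof. by rewrite -mxcolD; apply/eq_mxcolP=> k; rewrite ffunE. Qed.

Lemma unfold_tensorN m n l (A : tensor H m n l) :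
  unfold_tensor (- A) = - unfold_tensor A.
Proof. by rewrite -mxcolN; apply/eq_mxcolP=> k; rewrite ffunE. Qed.

Lemma unfold_tensorZ m n l a (A : tensor H m n l) :
  unfold_tensor (a *: A) = a *: unfold_tensor A.
Proof.
by apply/matrixP=> i j; rewrite !mxE ffunE mxE.
Qed.

(** Over a noncommutative ring this is the scaling that commutes with mode3. *)
Definition scaletensor_right m n l (A : tensor H m n l) (a : H) : tensor H m n l :=
  [ffun k => scalemx_right (A k) a].

Lemma unfold_tensor_scale_right m n l (A : tensor H m n l) a :
  unfold_tensor (scaletensor_right A a) = scalemx_right (unfold_tensor A) a.
Proof.
by apply/matrixP=> i j; rewrite !mxE ffunE mxE.
Qed.

Lemma mode3_scale_right m n l l' (T : 'M[H]_(l', l)) (A : tensor H m n l) a :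
  mode3 T (scaletensor_right A a) = scaletensor_right (mode3 T A) a.
Proof.
apply/ffunP=> p; rewrite !ffunE; apply/matrixP=> i j; rewrite !mxE !summxE mulr_suml.
by apply: eq_bigr => q _; rewrite ffunE !mxE mulrA.
Qed.

Lemma fold_circ_kron m r n l (Xe Xi Xj Xk : tensor H m r l) (Ti Tj Tk : 'M[H]_l)
    (i j k : H) (B : tensor H r n l) :
  fold_tensor ((circ Xe + i *: (circ Xi *m kron Ti (1%:M : 'M_r))
      + j *: (circ Xj *m kron Tj (1%:M : 'M_r))
      + k *: (circ Xk *m kron Tk (1%:M : 'M_r))) *m unfold_tensor B) =
  cconv Xe B + i *: cconv Xi (mode3 Ti B) + j *: cconv Xj (mode3 Tj B) +
    k *: cconv Xk (mode3 Tk B).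
Proof.
have term a (X : tensor H m r l) T :
    a *: (circ X *m kron T (1%:M : 'M_r)) *m unfold_tensor B =
    unfold_tensor (a *: cconv X (mode3 T B)).
  by rewrite -scalemxAl -mulmxA kron_unfold circ_unfold unfold_tensorZ.
by rewrite !mulmxDl !term circ_unfold -!unfold_tensorD fold_unfoldK.
Qed.

Lemma fold_kron_scale m n l (Xe Xi Xj Xk : tensor H m n l) (Ti Tj Tk : 'M[H]_l)
    (i j k : H) :
  fold_tensor (unfold_tensor Xe
      - scalemx_right (kron Ti (1%:M : 'M_m) *m unfold_tensor Xi) i
      - scalemx_right (kron Tj (1%:M : 'M_m) *m unfold_tensor Xj) j
      - scalemx_right (kron Tk (1%:M : 'M_m) *m unfold_tensor Xk) k) =
  Xe - scaletensor_right (mode3 Ti Xi) i - scaletensor_right (mode3 Tj Xj) j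
    - scaletensor_right (mode3 Tk Xk) k.
Proof.
rewrite !kron_unfold -!unfold_tensor_scale_right -!unfold_tensorN.
by rewrite -!unfold_tensorD fold_unfoldK.
Qed.

Lemma tensorDE m n l (A B : tensor H m n l) t : (A + B) t = A t + B t.
Proof. by rewrite ffunE. Qed.

Lemma tensorNE m n l (A : tensor H m n l) t : (- A) t = - A t.
Proof. by rewrite ffunE. Qed.

Lemma adjq_scale_left m n (A : 'M[H]_(m, n)) a : conjq a = - a ->
  scalemx_right (adjq A) a = - adjq (a *: A).
Proof.
by move=> aN; apply/matrixP=> i j; rewrite !mxE conjqM aN mulrN opprK.
Qed.

End BlockProducts.

(** An isometry along the third mode acts on each fibre separately. *)
Lemma sqfrob_mode3 (R : rcfType) m n l (T : 'M[quaternion R]_l)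
    (A : tensor (quaternion R) m n l) : adjq T *m T = 1%:M ->
  \sum_p sqfrob (mode3 T A p) = \sum_p sqfrob (A p).
Proof.
move=> T1.
have fibre (B : tensor (quaternion R) m n l) :
    \sum_p sqfrob (B p) = \sum_i \sum_j sqfrob (\col_p B p i j).
  rewrite exchange_big; apply: eq_bigr => i _; rewrite exchange_big.
  apply: eq_bigr => j _; apply: eq_bigr => p _.
  by rewrite big_ord1 mxE.
rewrite !fibre; apply: eq_bigr => i _; apply: eq_bigr => j _.
rewrite -[RHS](sqfrob_mul _ T1); congr sqfrob; apply/colP=> p.
rewrite !mxE ffunE summxE; apply: eq_bigr => q _.
by rewrite !mxE.
Qed.

Lemma subo_inj n (q : 'I_n) : injective (fun p => subo p q).
Proof.
move=> p p' /(congr1 val) /= /eqP; rewrite eqn_modDr !modn_small // => /eqP.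
exact: val_inj.
Qed.

Lemma addn_oppo n (p : 'I_n) : ((p + oppo p) %% n = 0)%N.
Proof. by rewrite /= modnDmr subnKC ?modnn // ltnW. Qed.

Lemma oppo_inj n : injective (@oppo n).
Proof.
move=> p q e; have := addn_oppo p; rewrite -(addn_oppo q) e => /eqP.
by rewrite eqn_modDr !modn_small // => /eqP/val_inj.
Qed.

Section Transform.
Variables (R : realType) (l : nat).
Hypothesis l_gt0 : (0 < l)%N.
Local Notation H := (quaternion R).

Definition dft (nu : H) m n (A : tensor H m n l) : tensor H m n l :=
  mode3 (real_quat (Num.sqrt l%:R) *: Fmx nu l) A.

Definition idft (nu : H) m n (A : tensor H m n l) : tensor H m n l :=
  mode3 (real_quat (Num.sqrt l%:R)^-1 *: adjq (Fmx nu l)) A.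

Let sqrtl_neq0 : Num.sqrt l%:R != 0 :> R.
Proof. by rewrite gt_eqF // sqrtr_gt0 ltr0n. Qed.

Lemma dftE nu m n (A : tensor H m n l) p :
  dft nu A p = \sum_(q < l) rootq nu l (p * q) *: A q.
Proof.
rewrite ffunE; apply: eq_bigr => q _.
by rewrite mxE FmxE mulrA -rmorphM divff // rmorph1 mul1r.
Qed.

Lemma dftK nu m n : unit_pure nu -> cancel (@dft nu m n) (@idft nu m n).
Proof.
move=> /Fmx_unitary/(_ l_gt0)[F1 F2] A; rewrite /idft /dft -mode3M.
rewrite mulmx_realZ -scalemxAl F1 scalerA -rmorphM divff // rmorph1 scale1r.
exact: mode3_1.
Qed.

Lemma idftK nu m n : unit_pure nu -> cancel (@idft nu m n) (@dft nu m n).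
Proof.
move=> /Fmx_unitary/(_ l_gt0)[F1 F2] A; rewrite /idft /dft -mode3M.
rewrite mulmx_realZ -scalemxAl F2 scalerA -rmorphM mulVf // rmorph1 scale1r.
exact: mode3_1.
Qed.

Lemma parseval nu m n (A : tensor H m n l) : unit_pure nu ->
  \sum_p sqfrob (dft nu A p) = l%:R * \sum_p sqfrob (A p).
Proof.
move=> /Fmx_unitary/(_ l_gt0)[F1 F2]; rewrite /dft mode3Z -(sqfrob_mode3 A F1).
rewrite mulr_sumr; apply: eq_bigr => p _; rewrite /sqfrob mulr_sumr.
apply: eq_bigr => i _; rewrite mulr_sumr; apply: eq_bigr => j _.
by rewrite ffunE mxE normsqM normsq_real sqr_sqrtr ?ler0n.
Qed.

Lemma idft_diag nu m n (D : tensor H m n l) : f_diagonal D -> f_diagonal (idft nu D).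
Proof.
move=> D_diag k; apply/is_diag_mxP => i j ij; rewrite ffunE summxE big1 // => q _.
by rewrite mxE (is_diag_mxP (D_diag q)) ?mulr0.
Qed.

(** Real slices commute with the powers of exp(-2 pi nu / l), so the usual convolution
    theorem holds when the left factor is real. *)
Lemma dft_cconv nu m r n (X : tensor R m r l) (B : tensor H r n l) t :
  unit_pure nu ->
  dft nu (cconv (real_tensor X) B) t = dft nu (real_tensor X) t *m dft nu B t.
Proof.
move=> nu_unit; rewrite !dftE mulmx_sumr.
under eq_bigr => p _ do rewrite ffunE scaler_sumr.
rewrite exchange_big; apply: eq_bigr => q _.
rewrite mulmx_suml [RHS](reindex_inj (@subo_inj l q)); apply: eq_bigr => p _.
have real_comm a (Y : 'M[H]_(r, n)) k :
    real_tensor X k *m (a *: Y) = a *: (real_tensor X k *m Y).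
  apply/matrixP=> i j; rewrite !mxE mulr_sumr; apply: eq_bigr => s _.
  by rewrite !ffunE !mxE !mulrA real_quatC.
rewrite -scalemxAl real_comm scalerA; congr (_ *: _).
rewrite -rootqD // rootqD // rootq_mulr_mod // -rootqD // -mulnDr -addnA subnK 1?ltnW //.
by rewrite mulnDr rootqD // [(t * l)%N]mulnC
  [rootq nu l (l * t)]rootqX // rootqn // expr1n mulr1.
Qed.

Lemma dft_scale nu nu' al m n (A : tensor H m n l) t : nu * al = al * nu' ->
  dft nu (al *: A) t = al *: dft nu' A t.
Proof.
move=> move_al; rewrite !dftE scaler_sumr; apply: eq_bigr => q _.
by rewrite ffunE !scalerA (expq_move _ move_al).
Qed.

(** Replacing the slice index s by - s conjugates z^(t s), and transposition of a real
    slice is its adjoint. *)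
Lemma dft_trtensor nu m n (X : tensor R m n l) t : unit_pure nu ->
  dft nu (real_tensor (trtensor X)) t = adjq (dft nu (real_tensor X) t).
Proof.
move=> nu_unit; rewrite !dftE; apply/matrixP=> i j.
rewrite adjqE !summxE raddf_sum [RHS](reindex_inj (@oppo_inj l)).
apply: eq_bigr => s _; rewrite !ffunE !mxE /= conjqM conjq_real -real_quatC.
congr (_ * _); symmetry; apply: conjq_rootq => //.
rewrite rootqD // rootq_mulr_mod // -rootqD // -mulnDr subnK 1?ltnW //.
by rewrite [(t * l)%N]mulnC rootqX // rootqn // expr1n.
Qed.

(** The matrices T_al re-express a transform with axis mu as one with axis mu_al. *)
Lemma dft_Tmx mu nu m n (A : tensor H m n l) : unit_pure nu ->
  dft nu (mode3 (Tmx mu nu l) A) = dft mu A.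
Proof.
move=> /Fmx_unitary/(_ l_gt0)[_ F2]; rewrite /dft -mode3M -scalemxAl /Tmx mulmxA.
by rewrite F2 mul1mx.
Qed.

Lemma dft_adj_Tmx mu nu m n (A : tensor H m n l) : unit_pure mu ->
  dft mu (mode3 (adjq (Tmx mu nu l)) A) = dft nu A.
Proof.
move=> /Fmx_unitary/(_ l_gt0)[_ F2]; rewrite /dft -mode3M -scalemxAl /Tmx.
by rewrite adjqM adjqK mulmxA F2 mul1mx.
Qed.

Lemma tensor_parts m n (A : tensor H m n l) :
  A = real_tensor (part_e A) + quat_i *: real_tensor (part_i A) +
      quat_j *: real_tensor (part_j A) + quat_k *: real_tensor (part_k A).
Proof.
apply/ffunP=> t; apply/matrixP=> i j; rewrite !ffunE !mxE.
by apply: quatP; rewrite !quatE /=; split; ring.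
Qed.

Lemma gQt_prodE mu m r n (A : tensor H m r l) (B : tensor H r n l) :
  gQt_prod mu A B = cconv (real_tensor (part_e A)) B +
    quat_i *: cconv (real_tensor (part_i A)) (mode3 (T_i mu l) B) +
    quat_j *: cconv (real_tensor (part_j A)) (mode3 (T_j mu l) B) +
    quat_k *: cconv (real_tensor (part_k A)) (mode3 (T_k mu l) B).
Proof. exact: fold_circ_kron. Qed.

Lemma conjtrE mu m n (A : tensor H m n l) :
  conjtr mu A = real_tensor (trtensor (part_e A)) -
    scaletensor_right (mode3 (adjq (T_i mu l)) (real_tensor (trtensor (part_i A)))) quat_i -
    scaletensor_right (mode3 (adjq (T_j mu l)) (real_tensor (trtensor (part_j A)))) quat_j -
    scaletensor_right (mode3 (adjq (T_k mu l)) (real_tensor (trtensor (part_k A)))) quat_k.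
Proof. exact: fold_kron_scale. Qed.

Lemma dftD nu m n (A B : tensor H m n l) : dft nu (A + B) = dft nu A + dft nu B.
Proof. exact: mode3D. Qed.

Lemma dftN nu m n (A : tensor H m n l) : dft nu (- A) = - dft nu A.
Proof.
by apply/ffunP=> p; rewrite [RHS]ffunE !dftE -sumrN; apply: eq_bigr => q _;
   rewrite ffunE scalerN.
Qed.

Section Axis.
Variable mu : H.
Hypothesis mu_unit : unit_pure mu.

Let gQt_term nu al m r n (X : tensor R m r l) (B : tensor H r n l) t :
  unit_pure nu -> mu * al = al * nu ->
  dft mu (al *: cconv (real_tensor X) (mode3 (Tmx mu nu l) B)) t =
  dft mu (al *: real_tensor X) t *m dft mu B t.
Proof.
move=> nu_unit move_al; rewrite !(dft_scale _ _ move_al) dft_cconv // dft_Tmx //.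
by rewrite scalemxAl.
Qed.

Theorem dft_gQt_prod m r n (A : tensor H m r l) (B : tensor H r n l) t :
  dft mu (gQt_prod mu A B) t = dft mu A t *m dft mu B t.
Proof.
rewrite gQt_prodE [A in RHS]tensor_parts !dftD !tensorDE !mulmxDl dft_cconv //.
have Mi := mu_i_move mu_unit; have Mj := mu_j_move mu_unit.
have Mk := mu_k_move mu_unit.
congr (_ + _ + _ + _); first exact: (gQt_term _ _ _ (unit_pure_mu_i mu_unit) Mi).
  exact: (gQt_term _ _ _ (unit_pure_mu_j mu_unit) Mj).
exact: (gQt_term _ _ _ (unit_pure_mu_k mu_unit) Mk).
Qed.

Let conjtr_term nu al m n (X : tensor R m n l) t :
  unit_pure nu -> mu * al = al * nu -> conjq al = - al ->
  dft mu (- scaletensor_right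
            (mode3 (adjq (Tmx mu nu l)) (real_tensor (trtensor X))) al) t =
  adjq (dft mu (al *: real_tensor X) t).
Proof.
move=> nu_unit move_al alN; rewrite (dft_scale _ _ move_al) dftN tensorNE.
rewrite -[RHS]opprK -adjq_scale_left // -dft_trtensor // -(dft_adj_Tmx nu _ mu_unit).
by rewrite {1}/dft mode3_scale_right ffunE.
Qed.

Theorem dft_conjtr m n (A : tensor H m n l) t :
  dft mu (conjtr mu A) t = adjq (dft mu A t).
Proof.
rewrite conjtrE [A in RHS]tensor_parts !dftD !tensorDE !adjqD -dft_trtensor //.
have Ni : conjq (@quat_i R) = - quat_i by apply: quatP; rewrite !quatE /= oppr0.
have Nj : conjq (@quat_j R) = - quat_j by apply: quatP; rewrite !quatE /= oppr0.
have Nk : conjq (@quat_k R) = - quat_k by apply: quatP; rewrite !quatE /= oppr0.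
by rewrite (conjtr_term _ _ (unit_pure_mu_i mu_unit) (mu_i_move mu_unit) Ni)
  (conjtr_term _ _ (unit_pure_mu_j mu_unit) (mu_j_move mu_unit) Nj)
  (conjtr_term _ _ (unit_pure_mu_k mu_unit) (mu_k_move mu_unit) Nk).
Qed.

Lemma dft_idtensor n t : dft mu (idtensor R n l) t = 1%:M.
Proof.
rewrite dftE (bigD1 (Ordinal l_gt0)) //= muln0 rootq0 scale1r ffunE /= big1 ?addr0 //.
move=> q q_neq0; rewrite ffunE ifN ?scaler0 //.
Qed.

(** Both defining equations can be checked after the transform, where they become the
    slicewise ones. *)
Lemma unitary_tensor_dft n (U : tensor H n n l) :
  (forall t, unitaryq (dft mu U t)) -> unitary_tensor mu U.
Proof.
move=> U_unitary; split; apply: (can_inj (dftK mu_unit)); apply/ffunP=> t;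
  have [U1 U2] := U_unitary t; by rewrite dft_gQt_prod dft_conjtr dft_idtensor.
Qed.

End Axis.

(** Read as a formula for the norm in terms of the transform, so that only the squared
    norms of the transformed slices have to be compared. *)
Lemma frobenius_dft mu m n (A : tensor H m n l) : unit_pure mu ->
  frobenius A = Num.sqrt (l%:R^-1 * \sum_t sqfrob (dft mu A t)).
Proof.
move=> mu_unit; rewrite parseval // mulKf ?pnatr_eq0 -?lt0n //.
congr Num.sqrt; apply: eq_bigr => t _; apply: eq_bigr => i _.
by apply: eq_bigr => j _; rewrite normsq_normq.
Qed.

End Transform.

(** * Singular value decomposition of quaternion tensors *)

Theorem theorem3p5 (R : realType) (n1 n2 n3 : nat)
    (hn1 : (0 < n1)%N) (hn2 : (0 < n2)%N) (hn3 : (0 < n3)%N)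
    (mu : quaternion R) (hmu : unit_pure mu)
    (A : tensor (quaternion R) n1 n2 n3) :
  exists (U : tensor (quaternion R) n1 n1 n3)
         (S : tensor (quaternion R) n1 n2 n3)
         (V : tensor (quaternion R) n2 n2 n3),
    [/\ A = gQt_prod mu (gQt_prod mu U S) (conjtr mu V),
        f_diagonal S,
        unitary_tensor mu U,
        unitary_tensor mu V
      & frobenius A = frobenius S].
Proof.
have [U_hat] := fin_all_exists (fun t => quaternion_svd (dft mu A t)).
move=> /fin_all_exists[S_hat] /fin_all_exists[V_hat] svd_hat.
pose lift m n (M : 'I_n3 -> 'M[quaternion R]_(m, n)) : tensor _ m n n3 :=
  idft mu [ffun t => M t].
have dft_lift m n (M : 'I_n3 -> 'M_(m, n)) t : dft mu (lift m n M) t = M t.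
  by rewrite idftK // ffunE.
exists (lift _ _ U_hat), (lift _ _ S_hat), (lift _ _ V_hat); split.
- apply: (can_inj (dftK hn3 hmu)); apply/ffunP=> t.
  by rewrite !dft_gQt_prod // dft_conjtr // !dft_lift; case: (svd_hat t).
- by apply: idft_diag => t; rewrite ffunE; case: (svd_hat t).
- by apply: unitary_tensor_dft => // t; rewrite dft_lift; case: (svd_hat t).
- by apply: unitary_tensor_dft => // t; rewrite dft_lift; case: (svd_hat t).
rewrite !(frobenius_dft hn3 _ hmu); congr (Num.sqrt (_ * _)); apply: eq_bigr => t _.
rewrite dft_lift; have [-> _ [U1 _] [V1 _]] := svd_hat t.
by rewrite -mulmxA sqfrob_mul // -sqfrob_adj adjqM adjqK sqfrob_mul // sqfrob_adj.
Qed.
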